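(* Let $\Sigma=\{0,1\}$ and $\mathbf{M}=\Sigma^*$. There is an input-decreasing transducer $\mathbf{t}$ over $\Sigma$ (with respect to the radix order on $\Sigma^*$) such that the iterated max-min operator $\mu^*=\mu_{\mathbf{t}}^*$ does not converge finitely on the language $\{1\}$; that is, there is no $i\in\mathbb{N}_0$ with $\mu^*\{1\}=\mu^i\{1\}$.
   Context: $\mathbb{N}_0$ is the set of nonnegative integers. The radix (quasi-lexicographic) order on $\{0,1\}^*$: $u\prec v$ iff either $u$ is shorter than $v$, or they have the same length, are different, and at the first position where they differ the symbol of $u$ is smaller than that of $v$. A transducer $\mathbf{t}$ over $\Sigma$ is a finite transducer $(Q,\Sigma,T,I,F)$ with finite transition set $T\subseteq Q\times\Sigma^*\times\Sigma^*\times Q$ and sets $I,F\subseteq Q$ of initial and final states; it realizes the relation $R(\mathbf{t})\subseteq\Sigma^*\times\Sigma^*$ of labels of its accepting paths. Write $y\in\mathbf{t}(x)$ iff $(x,y)\in R(\mathbf{t})$, $\mathbf{t}(X)=\bigcup_{x\in X}\mathbf{t}(x)$ for a language $X$, and $\mathbf{t}^{-1}$ for the transducer realizing the inverse relation. $\mathbf{t}$ is input-decreasing if $y\in\mathbf{t}(x)$ implies $y\prec x$, for all words $x,y$. For any language $X$: $\mathrm{I}(X)=\mathbf{M}\setminus(\mathbf{t}(X)\cup\mathbf{t}^{-1}(X))$ and $\mu X=\mathrm{I}(X)\setminus\mathbf{t}^{-1}(\mathrm{I}(X))$. Moreover $\mu^0X=X$, $\mu^{i+1}X=\mu(\mu^iX)$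 and $\mu^*X=\bigcup_{i\ge0}\mu^iX$. *)

(* Defs.v *)
From mathcomp Require Import all_boot finmap.
From mathcomp Require Import boolp classical_sets.

Set Implicit Arguments.
Unset Strict Implicit.
Unset Printing Implicit Defensive.

Local Open Scope classical_set_scope.

Record transducer (Sigma : finType) := Transducer {
  state : finType;
  transitions : {fset state * seq Sigma * seq Sigma * state};
  initial : {set state};
  final : {set state}
}.

Section Transducers.
Context {Sigma : finType}.
Implicit Types (t : transducer Sigma) (X : set (seq Sigma)).

(* [run t p x y q]: some path from [p] to [q], possibly empty, has input
   label [x] and output label [y]. *)
Inductive run t : state t -> seq Sigma -> seq Sigma -> state t -> Prop :=
| run_nil p : run p [::] [::] p
| run_cons p u v q x y r :
    (p, u, v, q) \in transitions t -> run q x y r -> run p (u ++ x) (v ++ y) r.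

Definition realized t : set (seq Sigma * seq Sigma) :=
  [set xy | exists p q : state t,
     [/\ p \in initial t, q \in final t & run p xy.1 xy.2 q]].

Definition app_word t (x : seq Sigma) : set (seq Sigma) :=
  [set y | realized t (x, y)].

Definition app_set t X : set (seq Sigma) := \bigcup_(x in X) app_word t x.

Definition inv_transducer t : transducer Sigma :=
  Transducer
    [fset (e.1.1.1, e.1.2, e.1.1.2, e.2) | e in transitions t]%fset
    (initial t) (final t).

Definition indep t X : set (seq Sigma) :=
  [set: seq Sigma] `\` (app_set t X `|` app_set (inv_transducer t) X).

Definition maxmin t X : set (seq Sigma) :=
  indep t X `\` app_set (inv_transducer t) (indep t X).

Definition maxmin_star t X : set (seq Sigma) :=
  \bigcup_(i in [set: nat]) iter i (maxmin t) X.

Lemma realized_inv t (x y : seq Sigma) :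
  realized (inv_transducer t) (x, y) <-> realized t (y, x).
Proof.
split=> -[p [q [pI qF /= r]]]; exists p, q; split=> //=.
- elim: r => [p'|p' u v q' x' y' r' + _ IH]; first exact: run_nil.
  case/imfsetP=> -[[[a b] c] d] /= e [-> -> -> ed].
  by rewrite ed in IH; apply: run_cons e IH.
- elim: r => [p'|p' u v q' x' y' r' e _ IH]; first exact: (@run_nil (inv_transducer t)).
  apply: (@run_cons (inv_transducer t)) IH.
  by apply/imfsetP; exists (p', u, v, q').
Qed.

End Transducers.

(* The letters 0 and 1 are [false] and [true]; letters are compared in [nat]
   through the coercion [nat_of_bool]. *)
Definition radix_lt (u v : seq bool) : Prop :=
  (size u < size v)%N \/
  size u = size v /\
  exists2 i, (i < size u)%N &
    (forall j, (j < i)%N -> nth false u j = nth false v j) /\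
    (nth false u i < nth false v i)%N.

Definition input_decreasing (t : transducer bool) : Prop :=
  forall x y, app_word t x y -> radix_lt y x.

(* Main.v *)
(* Think of the pairs [(x, y)] realized by [t] as edges [x -> y]; then [maxmin t X]
   consists of the vertices that have no neighbour in [X] and all of whose successors
   have one.  Take for [t] the deletion of a leading 1, so that the powers of 1 form
   the infinite path [... -> 111 -> 11 -> 1 -> eps].  Starting from [{1}], the operator
   climbs this path one odd power at a time: after [i] steps the powers of 1 present
   are exactly those with odd exponent at most [2 i + 1]. *)
Require Import Defs.
From mathcomp Require Import all_boot finmap boolp classical_sets zify.

Local Open Scope classical_set_scope.

(** State [false] deletes the leading 1; state [true] copies the rest. *)
Definition drop_one : transducer bool :=
  @Transducer bool bool
    [fset (false, [:: true], [::], true);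
          (true, [:: true], [:: true], true);
          (true, [:: false], [:: false], true)]%fset
    [set false]%SET [set true]%SET.

Lemma drop_one_transitions (p q : bool) (u v : seq bool) :
  (p, u, v, q) \in transitions drop_one <->
  q /\ if p then exists a, u = [:: a] /\ v = [:: a]
       else u = [:: true] /\ v = [::].
Proof.
rewrite !inE; split.
  by case/orP=> [/orP[]|] /eqP[-> -> -> ->]; do !split=> //; eexists; split.
case: q => -[//= _]; case: p => [[a [-> ->]]|[-> ->]]; last by rewrite eqxx.
by case: a; rewrite eqxx ?orbT.
Qed.

(** The premise [q] rules out the empty run at [false], which deletes nothing. *)
Lemma run_drop_one (p q : bool) (x y : seq bool) :
  run (t := drop_one) p x y q ->
  if p then x = y else q -> x = true :: y.
Proof.
elim=> {p q x y} [[]//|p u v q x y r /drop_one_transitions[qT uvE] _].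
by rewrite qT; case: p uvE => [[a [-> ->]]|[-> ->]] ->.
Qed.

Lemma run_drop_one_id (x : seq bool) : run (t := drop_one) true x x true.
Proof.
elim: x => [|a x IH]; first exact: run_nil.
apply: (@run_cons _ drop_one true [:: a] [:: a] true x x) IH.
by apply/drop_one_transitions; split=> //; exists a.
Qed.

Lemma realized_drop_one (x y : seq bool) :
  realized drop_one (x, y) <-> x = true :: y.
Proof.
split=> [[p [q []]]|->].
  by rewrite !inE => /eqP-> /eqP-> /run_drop_one; apply.
exists false, true; split; rewrite ?inE //=.
apply: (@run_cons _ drop_one false [:: true] [::] true y y).
  exact/drop_one_transitions.
exact: run_drop_one_id.
Qed.

Lemma indepP (Sigma : finType) (t : transducer Sigma) (X : set (seq Sigma)) x :
  indep t X x <->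
  forall y, X y -> ~ realized t (x, y) /\ ~ realized t (y, x).
Proof.
split=> [[_ nX] y Xy|nX].
  split=> r; apply: nX; [right|left]; exists y => //.
  exact/realized_inv.
split=> // -[] [y Xy r]; have [nxy nyx] := nX y Xy; first exact: nyx.
exact/nxy/realized_inv.
Qed.

Lemma maxminP (Sigma : finType) (t : transducer Sigma) (X : set (seq Sigma)) x :
  maxmin t X x <->
  indep t X x /\ forall y, realized t (x, y) -> ~ indep t X y.
Proof.
split=> -[Ix nI]; split=> //.
  by move=> y r Iy; apply: nI; exists y => //; apply/realized_inv.
by case=> y Iy /realized_inv r; apply: nI Iy.
Qed.

Lemma indep_drop_one (X : set (seq bool)) (x : seq bool) :
  indep drop_one X x <->
  ~ X (true :: x) /\ forall y, x = true :: y -> ~ X y.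
Proof.
split=> [/indepP nX|[nX1 nX2]].
  split=> [/nX[_]|y xE /nX[+ _]]; apply; exact/realized_drop_one.
apply/indepP => y Xy; split=> /realized_drop_one yE; first exact: nX2 Xy.
by apply: nX1; rewrite -yE.
Qed.

Lemma input_decreasing_drop_one : input_decreasing drop_one.
Proof. by move=> x y /realized_drop_one ->; left. Qed.

(** The iterates also contain other words, but no edge joins those to a power of 1, so the exponents
    can be followed alone. *)
Lemma iter_maxmin_drop_one (i k : nat) :
  iter i (maxmin drop_one) [set [:: true]] (nseq k true) <->
  odd k && (k <= i.*2.+1).
Proof.
elim: i k => [|i IH] k.
  by case: k => [|[|k]]; rewrite /= ?andbF; split.
rewrite iterS; set X := iter i _ _ in IH *.
(* Odd exponents have only even neighbours, none in [X]; an even [m] avoids [X] once [m - 1] exceeds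
   [2 i + 1]. *)
have indepE m : indep drop_one X (nseq m true) <-> odd m || (i.*2.+2 < m).
  rewrite indep_drop_one -[true :: _]/(nseq m.+1 true) IH.
  split=> [[nS nP]|mP].
    (* The empty word has no successor, but its predecessor 1 is in [X] for every [i]. *)
    case: m nS nP => [|m] nS nP; first by case: nS.
    by have := nP _ erefl; rewrite IH; lia.
  split=> [|y]; first by lia.
  by case: m mP => // m mP [<-]; rewrite IH; lia.
(* Past [2 i + 2] all powers are independent, so each one whose successor also lies there is
   removed; only [2 i + 3] is gained. *)
rewrite maxminP indepE.
split=> [[kP nI]|kP].
  case: k kP nI => // k kP nI.
  by have := nI (nseq k true); rewrite realized_drop_one indepE => /(_ erefl); lia.
split=> [|y /realized_drop_one]; first by lia.
by case: k kP => // k kP [<-]; rewrite indepE; lia.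
Qed.

Theorem theorem29 :
  exists t : transducer bool,
    input_decreasing t /\
    ~ (exists i : nat,
         maxmin_star t [set [:: true]] = iter i (maxmin t) [set [:: true]]).
Proof.
exists drop_one; split; first exact: input_decreasing_drop_one.
case=> i starE.
(* The exponent [2 i + 3] first appears at step [i + 1]. *)
have : maxmin_star drop_one [set [:: true]] (nseq i.*2.+3 true).
  by exists i.+1 => //; apply/iter_maxmin_drop_one; lia.
by rewrite starE => /iter_maxmin_drop_one; lia.
Qed.
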